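(* There exist at least $1154$ pairwise non-similar $7$-clusters and at least $435696$ pairwise non-similar $6$-clusters.
   Context: An integral point set is a set of points in the Euclidean plane $\mathbb{R}^2$, not all located on a line, such that all pairwise Euclidean distances are integers. It is in general position if no three of its points are on a line and no four of its points are on a circle. An $n$-cluster is an integral point set in $\mathbb{R}^2$ in general position that consists of $n$ points and has a representation using integer coordinates, i.e., it is isometric to a set of points of $\mathbb{Z}^2$. Two $n$-clusters are similar if, after dividing all pairwise distances of each of them by the greatest common divisor of its pairwise distances, the resulting point sets are isometric (equivalently, one is the image of the other under a similarity of the plane). *)

(* Defs.v *)
From Stdlib Require Import Reals ZArith NArith.
From Stdlib Require Import Ensembles Finite_sets Image.

Open Scope R_scope.

Definition point : Type := (R * R)%type.

Definition pointset : Type := Ensemble point.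

Definition dist (p q : point) : R := dist_euc (fst p) (snd p) (fst q) (snd q).

Definition on_a_line (S : pointset) : Prop :=
  exists a b c : R, (a <> 0 \/ b <> 0) /\
    forall p, In _ S p -> a * fst p + b * snd p + c = 0.

Definition on_a_circle (S : pointset) : Prop :=
  exists (o : point) (r : R), 0 < r /\ forall p, In _ S p -> dist o p = r.

Definition integral_point_set (P : pointset) : Prop :=
  ~ on_a_line P /\
  forall p q, In _ P p -> In _ P q -> exists k : Z, dist p q = IZR k.

Definition general_position (P : pointset) : Prop :=
  (forall S, Included _ S P -> cardinal _ S 3 -> ~ on_a_line S) /\
  (forall S, Included _ S P -> cardinal _ S 4 -> ~ on_a_circle S).

(* Injectivity of [f] on [P] follows from preservation of distances. *)
Definition isometric (P Q : pointset) : Prop :=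
  exists f : point -> point,
    (forall p, In _ P p -> In _ Q (f p)) /\
    (forall q, In _ Q q -> exists p, In _ P p /\ f p = q) /\
    (forall p p', In _ P p -> In _ P p' -> dist (f p) (f p') = dist p p').

Definition integer_point (p : point) : Prop :=
  exists a b : Z, p = (IZR a, IZR b).

Definition cluster (n : nat) (P : pointset) : Prop :=
  integral_point_set P /\ general_position P /\ cardinal _ P n /\
  exists Q, isometric P Q /\ forall q, In _ Q q -> integer_point q.

Definition divides_distances (d : Z) (P : pointset) : Prop :=
  forall p q, In _ P p -> In _ P q -> exists k : Z, dist p q = IZR (d * k).

(* As in [Zis_gcd], the gcd is characterized by divisibility; [0 <= g] selects
   the nonnegative one.  It is unique, and positive as soon as [P] has two
   points. *)
Definition distance_gcd (P : pointset) (g : Z) : Prop :=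
  (0 <= g)%Z /\ divides_distances g P /\
  forall d, divides_distances d P -> (d | g)%Z.

Definition scale (c : R) (P : pointset) : pointset :=
  Im _ _ P (fun p => (c * fst p, c * snd p)).

(* Dividing all distances by [g] amounts to applying a homothety of
   ratio [/ g]. *)
Definition similar (P Q : pointset) : Prop :=
  exists g h : Z, distance_gcd P g /\ distance_gcd Q h /\
    isometric (scale (/ IZR g) P) (scale (/ IZR h) Q).

(* Main.v *)
(** A one-parameter family of seven points: [0], [1] and five points whose
    coordinates are rational functions of [t].  All determinants deciding
    collinearity and concyclicity of its points factor into [t], [1 - t^2],
    [1 - 9 t^2], [1 - 3 t^2] and positive polynomials, and every distance is a
    rational function of [t], up to a factor
    [w = sqrt (81 t^4 + 10 t^2 + 9)].  The elliptic curve
    [w^2 = 81 t^4 + 10 t^2 + 9] has infinitely many rational points: doubling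
    [(2/5, 89/25)] increases the 2-adic valuation of [t] by one at each step, so
    the parameters obtained are distinct and avoid the degenerate values.
    Clearing denominators gives a 7-cluster, and its first six points a
    6-cluster, for each of them.  The quotient of two distances is a similarity
    invariant, a cluster has finitely many of them, and one fixed quotient takes
    distinct values along the sequence; hence arbitrarily many pairwise
    non-similar clusters can be chosen one after the other. *)

From Stdlib Require Import Finite_sets_facts Classical List Sorted Lra Lia Psatz.
From Stdlib Require Import Reals ZArith NArith.
From Stdlib Require Import Ensembles Finite_sets Image.
Require Import Defs.
Import ListNotations.

Open Scope R_scope.

(** * Rational reals and common denominators *)

Definition rational (x : R) : Prop :=
  exists a b : Z, b <> 0%Z /\ x = IZR a / IZR b.

Lemma rational_IZR (k : Z) : rational (IZR k).
Proof. exists k, 1%Z. split; [lia | field]. Qed.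

Lemma rational_plus (x y : R) : rational x -> rational y -> rational (x + y).
Proof.
  intros (a & b & Hb & ->) (c & d & Hd & ->).
  exists (a * d + c * b)%Z, (b * d)%Z. split; [lia |].
  rewrite plus_IZR, !mult_IZR. field. split; now apply not_0_IZR.
Qed.

Lemma rational_opp (x : R) : rational x -> rational (- x).
Proof.
  intros (a & b & Hb & ->). exists (- a)%Z, b. split; [exact Hb |].
  rewrite opp_IZR. field. now apply not_0_IZR.
Qed.

Lemma rational_minus (x y : R) : rational x -> rational y -> rational (x - y).
Proof. intros Hx Hy. apply rational_plus; [exact Hx | now apply rational_opp]. Qed.

Lemma rational_mult (x y : R) : rational x -> rational y -> rational (x * y).
Proof.
  intros (a & b & Hb & ->) (c & d & Hd & ->).
  exists (a * c)%Z, (b * d)%Z. split; [lia |].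
  rewrite !mult_IZR. field. split; now apply not_0_IZR.
Qed.

(** The convention [/ 0 = 0] covers the zero case, so that [rational_tac] meets no side condition at
    an inverse. *)
Lemma rational_inv (x : R) : rational x -> rational (/ x).
Proof.
  intros (a & b & Hb & ->). destruct (Z.eq_dec a 0) as [-> | Ha].
  - exists 0%Z, 1%Z. split; [lia |].
    unfold Rdiv. rewrite !Rmult_0_l. apply Rinv_0.
  - exists b, a. split; [exact Ha |]. field. split; now apply not_0_IZR.
Qed.

Lemma rational_div (x y : R) : rational x -> rational y -> rational (x / y).
Proof. intros Hx Hy. apply rational_mult; [exact Hx | now apply rational_inv]. Qed.

Lemma rational_pow (x : R) (n : nat) : rational x -> rational (x ^ n).
Proof.
  intros Hx. induction n as [| n IH]; [apply (rational_IZR 1) |].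
  simpl. now apply rational_mult.
Qed.

Lemma rational_Rabs (x : R) : rational x -> rational (Rabs x).
Proof.
  intros Hx. unfold Rabs. destruct (Rcase_abs x); [now apply rational_opp | exact Hx].
Qed.

Ltac rational_tac :=
  repeat first
    [ assumption | apply rational_IZR | apply rational_plus | apply rational_minus
    | apply rational_opp | apply rational_mult | apply rational_inv
    | apply rational_pow ].

Lemma common_denominator (l : list R) :
  Forall rational l ->
  exists N : Z, (0 < N)%Z /\ Forall (fun x => exists k : Z, IZR N * x = IZR k) l.
Proof.
  induction 1 as [| x l (a & b & Hb & ->) _ (N & HN & IH)].
  - exists 1%Z. split; [lia | constructor].
  (* The square [b * b] keeps the common denominator positive whatever the sign of [b]. *)
  - exists (N * (b * b))%Z. split; [nia |]. constructor.
    + exists (N * b * a)%Z. rewrite !mult_IZR. field. now apply not_0_IZR.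
    + revert IH. apply Forall_impl. intros x (k & Hk).
      exists (b * b * k)%Z. rewrite !mult_IZR, <- Hk. ring.
Qed.

(** * Distances, collinearity and concyclicity determinants, homotheties *)

Definition homothety (c : R) (p : point) : point := (c * fst p, c * snd p).

Definition config (f : nat -> point) (n : nat) : pointset :=
  fun p => exists i, (i < n)%nat /\ p = f i.

Lemma dist_sqr (p q : point) :
  dist p q ^ 2 = (fst p - fst q) ^ 2 + (snd p - snd q) ^ 2.
Proof.
  unfold dist, dist_euc. rewrite pow2_sqrt; [unfold Rsqr; ring |].
  apply Rplus_le_le_0_compat; apply Rle_0_sqr.
Qed.

Lemma dist_ge0 (p q : point) : 0 <= dist p q.
Proof. apply sqrt_pos. Qed.

(** Distances are nonnegative, so a square root [d] of the squared distance is right up to sign.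
    Explicit distances below thus reduce to a [field] identity, and the sign of the formula need not
    be known. *)
Lemma dist_unique (p q : point) (d : R) :
  (fst p - fst q) ^ 2 + (snd p - snd q) ^ 2 = d ^ 2 -> dist p q = Rabs d.
Proof.
  intros H. rewrite <- dist_sqr in H.
  rewrite <- (Rabs_pos_eq (dist p q)) by apply dist_ge0.
  apply Rsqr_eq_abs_0. unfold Rsqr. nra.
Qed.

Lemma dist_homothety (c : R) (p q : point) :
  dist (homothety c p) (homothety c q) = Rabs c * dist p q.
Proof.
  rewrite (dist_unique _ _ (c * dist p q)).
  - rewrite Rabs_mult, (Rabs_pos_eq (dist p q)) by apply dist_ge0. reflexivity.
  - rewrite Rpow_mult_distr, dist_sqr. unfold homothety, fst, snd. ring.
Qed.

Lemma dist_refl (p : point) : dist p p = 0.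
Proof. rewrite (dist_unique p p 0) by ring. apply Rabs_R0. Qed.

Lemma dist_sym (p q : point) : dist p q = dist q p.
Proof. unfold dist. apply distance_symm. Qed.

(* Twice the signed area of the triangle [p q r]. *)
Definition area (p q r : point) : R :=
  (fst q - fst p) * (snd r - snd p) - (fst r - fst p) * (snd q - snd p).

Definition norm2 (p : point) : R := fst p ^ 2 + snd p ^ 2.

(* The 4x4 determinant with rows [(norm2 p, fst p, snd p, 1)]. *)
Definition cocirc (p q r s : point) : R :=
  norm2 p * area q r s - norm2 q * area p r s + norm2 r * area p q s
  - norm2 s * area p q r.

Lemma area_homothety (c : R) (p q r : point) :
  area (homothety c p) (homothety c q) (homothety c r) = c ^ 2 * area p q r.
Proof. unfold area, homothety, fst, snd. ring. Qed.

Lemma cocirc_homothety (c : R) (p q r s : point) :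
  cocirc (homothety c p) (homothety c q) (homothety c r) (homothety c s)
  = c ^ 4 * cocirc p q r s.
Proof. unfold cocirc, norm2, area, homothety, fst, snd. ring. Qed.

(** Subtracting line equations gives two linear relations between the coordinate differences.
    Multiplied by whichever of [a], [b] is nonzero, the area is a combination of them. *)
Lemma line_area (S : pointset) (p q r : point) :
  on_a_line S -> In _ S p -> In _ S q -> In _ S r -> area p q r = 0.
Proof.
  intros (a & b & c & Hab & HS) Hp Hq Hr. apply HS in Hp, Hq, Hr.
  assert (Hq' : a * (fst q - fst p) + b * (snd q - snd p) = 0) by lra.
  assert (Hr' : a * (fst r - fst p) + b * (snd r - snd p) = 0) by lra.
  unfold area.
  set (dxq := fst q - fst p) in *. set (dyq := snd q - snd p) in *.
  set (dxr := fst r - fst p) in *. set (dyr := snd r - snd p) in *.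
  destruct Hab as [Ha | Hb].
  - apply Rmult_eq_reg_l with a; [| exact Ha].
    transitivity ((a * dxq + b * dyq) * dyr - (a * dxr + b * dyr) * dyq); [ring |].
    rewrite Hq', Hr'. ring.
  - apply Rmult_eq_reg_l with b; [| exact Hb].
    transitivity ((a * dxr + b * dyr) * dxq - (a * dxq + b * dyq) * dxr); [ring |].
    rewrite Hq', Hr'. ring.
Qed.

(** On a circle [norm2] agrees with an affine function of the coordinates, so the first column of
    the determinant depends linearly on the other three. *)
Lemma circle_cocirc (S : pointset) (p q r s : point) :
  on_a_circle S -> In _ S p -> In _ S q -> In _ S r -> In _ S s ->
  cocirc p q r s = 0.
Proof.
  intros (o & d & _ & HS) Hp Hq Hr Hs.
  assert (E : forall x, In _ S x ->
    norm2 x = d ^ 2 - norm2 o + 2 * fst o * fst x + 2 * snd o * snd x).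
  { intros x Hx. rewrite <- (HS x Hx), dist_sqr. unfold norm2. ring. }
  unfold cocirc. rewrite (E p Hp), (E q Hq), (E r Hr), (E s Hs).
  unfold area. ring.
Qed.

(** * From rational configurations to clusters *)

(** Turns conditions on arbitrary subsets of three or four points into conditions on tuples of
    indices. The induction splits off the largest index first, hence the decreasing order. *)
Lemma cardinal_indices (f : nat -> point) (m n : nat) (S : pointset) :
  Included _ S (config f n) -> cardinal _ S m ->
  exists l, length l = m /\ StronglySorted gt l /\
    Forall (fun i => (i < n)%nat /\ In _ S (f i)) l.
Proof.
  revert m S. induction n as [| n IH]; intros m S HS Hm.
  - assert (S = Empty_set _) as ->.
    { apply Extensionality_Ensembles. split; intros p Hp; [| destruct Hp].
      destruct (HS p Hp) as (i & Hi & _). lia. }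
    exists []. rewrite (cardinal_unicity _ _ _ Hm _ (card_empty _)).
    repeat constructor.
  - destruct (classic (In _ S (f n))) as [Hn | Hn].
    + pose proof (card_soustr_1 _ _ _ Hm _ Hn) as Hm'.
      destruct (IH (pred m) (Subtract _ S (f n))) as (l & Hl & Hsort & Hall);
        [| exact Hm' |].
      { intros p [Hp Hpn]. destruct (HS p Hp) as (i & Hi & ->).
        exists i. split; [| reflexivity].
        destruct (Nat.eq_dec i n) as [-> | Hin]; [| lia].
        destruct Hpn. constructor. }
      exists (n :: l). split; [| split].
      (* For [m = 0] the value [pred m] would be wrong, but [S] contains [f n] and is not empty. *)
      * simpl. rewrite Hl. destruct m; [| reflexivity].
        rewrite (cardinalO_empty _ _ Hm) in Hn. destruct Hn.
      * constructor; [exact Hsort |].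
        revert Hall. apply Forall_impl. unfold gt. tauto.
      * constructor; [split; [lia | exact Hn] |].
        revert Hall. apply Forall_impl. intros i [Hi [Hi' _]]. split; [lia | exact Hi'].
    + destruct (IH m S) as (l & Hl & Hsort & Hall); [| exact Hm |].
      { intros p Hp. destruct (HS p Hp) as (i & Hi & ->).
        exists i. split; [| reflexivity].
        destruct (Nat.eq_dec i n) as [-> | Hin]; [contradiction | lia]. }
      exists l. split; [exact Hl |]. split; [exact Hsort |].
      revert Hall. apply Forall_impl. intros i [Hi Hi']. split; [lia | exact Hi'].
Qed.

Lemma cardinal_config (f : nat -> point) (n : nat) :
  (forall i j, (i < j < n)%nat -> f i <> f j) -> cardinal _ (config f n) n.
Proof.
  induction n as [| n IH]; intros Hf.
  - assert (config f 0 = Empty_set _) as ->; [| constructor].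
    apply Extensionality_Ensembles. split; intros p Hp; [| destruct Hp].
    destruct Hp as (i & Hi & _). lia.
  - assert (config f (S n) = Add _ (config f n) (f n)) as ->.
    { apply Extensionality_Ensembles. split; intros p Hp.
      - destruct Hp as (i & Hi & ->). destruct (Nat.eq_dec i n) as [-> | Hin].
        + right. constructor.
        + left. exists i. split; [lia | reflexivity].
      - destruct Hp as [p (i & Hi & ->) | p []].
        + exists i. split; [lia | reflexivity].
        + exists n. split; [lia | reflexivity]. }
    constructor.
    + apply IH. intros i j Hij. apply Hf. lia.
    + intros (i & Hi & E). apply (Hf i n); [lia | now symmetry].
Qed.

(** One integer [N] clears the denominators of all coordinates and all distances at once, while the
    determinants are only multiplied by nonzero powers of [N]. *)
Lemma cluster_config (f : nat -> point) (n : nat) :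
  (3 <= n)%nat ->
  (forall i j k, (k < j < i)%nat -> (i < n)%nat -> area (f i) (f j) (f k) <> 0) ->
  (forall i j k l, (l < k < j)%nat -> (j < i < n)%nat ->
     cocirc (f i) (f j) (f k) (f l) <> 0) ->
  (forall i, (i < n)%nat -> rational (fst (f i)) /\ rational (snd (f i))) ->
  (forall i j, (i < n)%nat -> (j < n)%nat -> rational (dist (f i) (f j))) ->
  exists N : R, N <> 0 /\ cluster n (config (fun i => homothety N (f i)) n).
Proof.
  intros Hn Harea Hcocirc Hcoord Hdist.
  pose (I := seq 0 n).
  destruct (common_denominator
    (map (fun i => fst (f i)) I ++ map (fun i => snd (f i)) I
     ++ map (fun ij => dist (f (fst ij)) (f (snd ij))) (list_prod I I)))
    as (N & HN & HZ).
  { rewrite !Forall_app, !Forall_map, !Forall_forall. repeat split.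
    - intros i Hi%in_seq. apply Hcoord. lia.
    - intros i Hi%in_seq. apply Hcoord. lia.
    - intros [i j] [Hi%in_seq Hj%in_seq]%in_prod_iff. apply Hdist; simpl; lia. }
  rewrite !Forall_app, !Forall_map, !Forall_forall in HZ.
  destruct HZ as (Hx & Hy & Hd).
  assert (HN0 : 0 < IZR N) by now apply (IZR_lt 0).
  set (g := fun i => homothety (IZR N) (f i)).
  (* Two coinciding points would have area zero with any third point. The third index exists because
     [3 <= n], and its position relative to [i] and [j] decides which ordered triple is used. *)
  assert (Hdistinct : forall i j, (i < j < n)%nat -> g i <> g j).
  { intros i j Hij E.
    assert (Hk : exists k, (k < n /\ k <> i /\ k <> j)%nat).
    { destruct i as [| [| i]]; [destruct j as [| [| j]] | | ].
      all: first [exists 0%nat; lia | exists 1%nat; lia | exists 2%nat; lia]. }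
    destruct Hk as (k & Hk & Hki & Hkj).
    assert (Ef : f i = f j).
    { unfold g, homothety in E. injection E as E1 E2.
      apply Rmult_eq_reg_l in E1, E2; try lra.
      destruct (f i), (f j). simpl in *. congruence. }
    destruct (Nat.lt_ge_cases k i) as [Hlt | Hge].
    - apply (Harea j i k); [lia | lia |]. rewrite Ef. unfold area. ring.
    - destruct (Nat.lt_ge_cases k j) as [Hlt' | Hge'].
      + apply (Harea j k i); [lia | lia |]. rewrite Ef. unfold area. ring.
      + apply (Harea k j i); [lia | lia |]. rewrite Ef. unfold area. ring. }
  assert (Hline : forall i j k, (k < j < i)%nat -> (i < n)%nat ->
    area (g i) (g j) (g k) <> 0).
  { intros i j k Hkj Hi. unfold g. rewrite area_homothety.
    apply Rmult_integral_contrapositive_currified; [apply pow_nonzero; lra |].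
    now apply Harea. }
  exists (IZR N). split; [lra |]. split; [split |].
  - intros HL. apply (Hline 2 1 0)%nat; [lia | lia |].
    apply (line_area _ _ _ _ HL); [exists 2%nat | exists 1%nat | exists 0%nat];
      (split; [lia | reflexivity]).
  - intros p q (i & Hi & ->) (j & Hj & ->). rewrite dist_homothety.
    rewrite Rabs_pos_eq by lra.
    apply (Hd (i, j)). apply in_prod_iff. split; apply in_seq; lia.
  - split; [split | split].
    + intros S HS HS3 HL. destruct (cardinal_indices g _ _ _ HS HS3) as (l & Hl & Hs & Ha).
      destruct l as [| i [| j [| k [|]]]]; try discriminate Hl.
      repeat match goal with
             | H : StronglySorted _ (_ :: _) |- _ => inversion_clear H
             | H : Forall _ (_ :: _) |- _ => inversion_clear H
             end.
      apply (Hline i j k); [lia | lia |].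
      apply (line_area S); tauto.
    + intros S HS HS4 HL. destruct (cardinal_indices g _ _ _ HS HS4) as (l & Hl & Hs & Ha).
      destruct l as [| i [| j [| k [| l' [|]]]]]; try discriminate Hl.
      repeat match goal with
             | H : StronglySorted _ (_ :: _) |- _ => inversion_clear H
             | H : Forall _ (_ :: _) |- _ => inversion_clear H
             end.
      apply (Hcocirc i j k l'); [lia | lia |].
      apply Rmult_eq_reg_l with (IZR N ^ 4); [| apply pow_nonzero; lra].
      rewrite <- cocirc_homothety, Rmult_0_r.
      apply (circle_cocirc S); tauto.
    + now apply cardinal_config.
    (* The scaled configuration already lies on the integer lattice, so the identity is the required
       isometry. *)
    + exists (config g n). split.
      * exists (fun p => p). split; [tauto |]. split; [| reflexivity].
        intros q Hq. exists q. tauto.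
      * intros q (i & Hi & ->).
        assert (HI : List.In i I) by (apply in_seq; lia).
        destruct (Hx i HI) as (a & Ha), (Hy i HI) as (b & Hb).
        exists a, b. unfold g, homothety. now rewrite Ha, Hb.
Qed.

(** * Quotients of distances as similarity invariants *)

Definition ratio_set (P : pointset) (x : R) : Prop :=
  exists p q r s, In _ P p /\ In _ P q /\ In _ P r /\ In _ P s /\
    dist r s <> 0 /\ x = dist p q / dist r s.

Lemma ratio_set_config_finite (f : nat -> point) (n : nat) :
  exists l : list R, forall x, ratio_set (config f n) x -> List.In x l.
Proof.
  pose (D := map (fun ij => dist (f (fst ij)) (f (snd ij)))
                 (list_prod (seq 0 n) (seq 0 n))).
  assert (HD : forall i j, (i < n)%nat -> (j < n)%nat -> List.In (dist (f i) (f j)) D).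
  { intros i j Hi Hj. apply in_map_iff. exists (i, j). split; [reflexivity |].
    apply in_prod; apply in_seq; lia. }
  exists (map (fun de => fst de / snd de) (list_prod D D)).
  intros x (p & q & r & s & (i & Hi & ->) & (j & Hj & ->) & (k & Hk & ->)
            & (l & Hl & ->) & _ & ->).
  apply in_map_iff. exists (dist (f i) (f j), dist (f k) (f l)).
  split; [reflexivity |]. apply in_prod; now apply HD.
Qed.

Lemma ratio_set_homothety (N : R) (f : nat -> point) (n : nat) (i j k l : nat) :
  N <> 0 -> (i < n)%nat -> (j < n)%nat -> (k < n)%nat -> (l < n)%nat ->
  dist (f k) (f l) <> 0 ->
  ratio_set (config (fun i => homothety N (f i)) n)
    (dist (f i) (f j) / dist (f k) (f l)).
Proof.
  intros HN Hi Hj Hk Hl Hkl.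
  assert (HN' : Rabs N <> 0) by now apply Rabs_no_R0.
  exists (homothety N (f i)), (homothety N (f j)),
         (homothety N (f k)), (homothety N (f l)).
  split; [now exists i |]. split; [now exists j |].
  split; [now exists k |]. split; [now exists l |]. split.
  - rewrite dist_homothety. now apply Rmult_integral_contrapositive_currified.
  - rewrite !dist_homothety. field. now split.
Qed.

Lemma distance_gcd_neq0 (P : pointset) (g : Z) (p q : point) :
  distance_gcd P g -> In _ P p -> In _ P q -> dist p q <> 0 -> IZR g <> 0.
Proof.
  intros (_ & Hg & _) Hp Hq Hpq E%eq_IZR_R0. destruct (Hg p q Hp Hq) as (k & Hk).
  apply Hpq. now rewrite Hk, E.
Qed.

(** Corresponding distances differ by one constant factor, which cancels in quotients. The pairs at
    nonzero distance force both gcds to be nonzero; otherwise the scaling would collapse the set to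
    a point. *)
Lemma similar_ratio_set (P Q : pointset) :
  (exists p q, In _ P p /\ In _ P q /\ dist p q <> 0) ->
  (exists p q, In _ Q p /\ In _ Q q /\ dist p q <> 0) ->
  similar P Q -> forall x, ratio_set P x <-> ratio_set Q x.
Proof.
  intros (p0 & q0 & Hp0 & Hq0 & Hpq0) (p1 & q1 & Hp1 & Hq1 & Hpq1)
         (g & h & Hg & Hh & f & Hf & Hsurj & Hiso).
  assert (Hg0 := distance_gcd_neq0 P g p0 q0 Hg Hp0 Hq0 Hpq0).
  assert (Hh0 := distance_gcd_neq0 Q h p1 q1 Hh Hp1 Hq1 Hpq1).
  assert (Hfwd : forall p, In _ P p -> exists q, In _ Q q /\
    homothety (/ IZR h) q = f (homothety (/ IZR g) p)).
  { intros p Hp.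
    assert (Hfp : In _ (scale (/ IZR h) Q) (f (homothety (/ IZR g) p))).
    { apply Hf. exists p; [exact Hp | reflexivity]. }
    inversion Hfp as [q Hq y E]. exists q. split; [exact Hq | now symmetry]. }
  assert (Hbwd : forall q, In _ Q q -> exists p, In _ P p /\
    homothety (/ IZR h) q = f (homothety (/ IZR g) p)).
  { intros q Hq. destruct (Hsurj (homothety (/ IZR h) q)) as (y & Hy & E).
    { exists q; [exact Hq | reflexivity]. }
    inversion Hy as [p Hp z Ez]. subst. exists p. split; [exact Hp | now symmetry]. }
  assert (Hdist : forall p p' q q', In _ P p -> In _ P p' ->
    homothety (/ IZR h) q = f (homothety (/ IZR g) p) ->
    homothety (/ IZR h) q' = f (homothety (/ IZR g) p') ->
    dist q q' = Rabs (IZR h) * Rabs (/ IZR g) * dist p p').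
  { intros p p' q q' Hp Hp' E E'.
    assert (Hpp : dist (homothety (/ IZR h) q) (homothety (/ IZR h) q')
                  = dist (homothety (/ IZR g) p) (homothety (/ IZR g) p')).
    { rewrite E, E'. apply Hiso.
      - exists p; [exact Hp | reflexivity].
      - exists p'; [exact Hp' | reflexivity]. }
    rewrite !dist_homothety in Hpp.
    rewrite Rmult_assoc, <- Hpp, <- Rmult_assoc, <- Rabs_mult, Rinv_r by exact Hh0.
    rewrite Rabs_R1. ring. }
  assert (Hc : Rabs (IZR h) * Rabs (/ IZR g) <> 0).
  { apply Rmult_integral_contrapositive_currified; apply Rabs_no_R0;
      [exact Hh0 | now apply Rinv_neq_0_compat]. }
  set (c := Rabs (IZR h) * Rabs (/ IZR g)) in *.
  intros x. split.
  - intros (p & q & r & s & Hp & Hq & Hr & Hs & Hrs & ->).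
    destruct (Hfwd p Hp) as (p' & Hp' & Ep), (Hfwd q Hq) as (q' & Hq' & Eq),
             (Hfwd r Hr) as (r' & Hr' & Er), (Hfwd s Hs) as (s' & Hs' & Es).
    exists p', q', r', s'. repeat (split; [assumption |]).
    rewrite (Hdist r s r' s'), (Hdist p q p' q') by assumption.
    split; [now apply Rmult_integral_contrapositive_currified | field; now split].
  - intros (p & q & r & s & Hp & Hq & Hr & Hs & Hrs & ->).
    destruct (Hbwd p Hp) as (p' & Hp' & Ep), (Hbwd q Hq) as (q' & Hq' & Eq),
             (Hbwd r Hr) as (r' & Hr' & Er), (Hbwd s Hs) as (s' & Hs' & Es).
    exists p', q', r', s'. repeat (split; [assumption |]).
    rewrite (Hdist r' s' r s) in * by assumption.
    rewrite (Hdist p' q' p q) by assumption.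
    assert (dist r' s' <> 0) by (intros E; apply Hrs; rewrite E; ring).
    split; [assumption | field; now split].
Qed.

(** * Greedy selection of pairwise non-similar sets *)

(** Pigeonhole: the first [S (length l)] values are distinct and cannot all fit into [l]. *)
Lemma injective_avoids_list (phi : nat -> R) (l : list R) :
  (forall m n, phi m = phi n -> m = n) -> exists n, ~ List.In (phi n) l.
Proof.
  intros Hinj. apply NNPP. intros Hno.
  assert (Hincl : incl (map phi (seq 0 (S (length l)))) l).
  { intros x Hx. apply in_map_iff in Hx. destruct Hx as (n & <- & _).
    apply NNPP. intros Hn. apply Hno. now exists n. }
  apply NoDup_incl_length in Hincl.
  - rewrite length_map, length_seq in Hincl. lia.
  - apply NoDup_map_NoDup_ForallPairs; [| apply seq_NoDup].
    intros m n _ _. apply Hinj.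
Qed.

(** [good] is a relation because the scaling factor of a cluster is given only by an existential
    statement. Both directions of non-similarity are recorded, since [ForallOrdPairs] compares an
    entry only with later ones while the theorem quantifies over all ordered pairs. *)
Lemma greedy_nonsimilar (good : nat -> pointset -> Prop) (phi : nat -> R) :
  (forall n, exists P, good n P) ->
  (forall m n, phi m = phi n -> m = n) ->
  (forall n P, good n P ->
     exists l : list R, forall x, ratio_set P x -> List.In x l) ->
  (forall n P, good n P ->
     ratio_set P (phi n) /\ exists p q, In _ P p /\ In _ P q /\ dist p q <> 0) ->
  forall N : nat, exists l : list pointset, length l = N /\
    Forall (fun P => exists n, good n P) l /\
    ForallOrdPairs (fun P Q => ~ similar P Q /\ ~ similar Q P) l.
Proof.
  intros Hex Hinj Hfin Hphi N. induction N as [| N (l & Hl & Hgood & Hpairs)].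
  - exists []. repeat constructor.
  (* [v] gathers the quotients of all sets chosen so far. The next set has a quotient [phi n]
     outside [v], and a similarity with an earlier set would put it into [v]. *)
  - assert (Hvals : exists v : list R,
      Forall (fun P => forall x, ratio_set P x -> List.In x v) l).
    { clear Hl Hpairs. induction Hgood as [| P l (n & Hn) _ (v & Hv)].
      - exists []. constructor.
      - destruct (Hfin n P Hn) as (u & Hu). exists (u ++ v). constructor.
        + intros x Hx. apply in_or_app. left. now apply Hu.
        + revert Hv. apply Forall_impl. intros Q HQ x Hx.
          apply in_or_app. right. now apply HQ. }
    destruct Hvals as (v & Hv), (injective_avoids_list phi v Hinj) as (n & Hn).
    destruct (Hex n) as (P & HP), (Hphi n P ltac:(assumption)) as (HPr & HPd).
    exists (P :: l). simpl. split; [now rewrite Hl |].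
    split; [constructor; [now exists n | exact Hgood] |].
    constructor; [| exact Hpairs].
    rewrite Forall_forall in *. intros Q HQ.
    destruct (Hgood Q HQ) as (m & Hm), (Hphi m Q Hm) as (_ & HQd).
    split; intros Hsim; apply Hn, (Hv Q HQ).
    + now apply (similar_ratio_set P Q).
    + now apply (similar_ratio_set Q P).
Qed.

Lemma ForallOrdPairs_nth (A : Type) (R : A -> A -> Prop) (l : list A) (d : A) :
  ForallOrdPairs R l -> forall i j, (i < j < length l)%nat -> R (nth i l d) (nth j l d).
Proof.
  induction 1 as [| a l Ha _ IH]; intros i j Hij; simpl in *; [lia |].
  destruct j as [| j]; [lia |]. destruct i as [| i].
  - rewrite Forall_forall in Ha. apply Ha, nth_In. lia.
  - apply IH. lia.
Qed.

Lemma nonsimilar_family_of_list (k : nat) (M : N) (l : list pointset) :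
  length l = N.to_nat M -> Forall (cluster k) l ->
  ForallOrdPairs (fun P Q => ~ similar P Q /\ ~ similar Q P) l ->
  exists C : N -> pointset,
    (forall i : N, (i < M)%N -> cluster k (C i)) /\
    (forall i j : N, (i < M)%N -> (j < M)%N -> i <> j -> ~ similar (C i) (C j)).
Proof.
  (* The empty set is the default outside the range [i < M]. *)
  intros Hl Hk Hpairs. exists (fun i => nth (N.to_nat i) l (Empty_set _)). split.
  - intros i Hi. rewrite Forall_forall in Hk. apply Hk, nth_In. lia.
  - intros i j Hi Hj Hij.
    assert (Hnth := ForallOrdPairs_nth pointset _ l (Empty_set _) Hpairs).
    destruct (Nat.lt_ge_cases (N.to_nat i) (N.to_nat j)) as [Hlt | Hge].
    + apply (Hnth (N.to_nat i) (N.to_nat j)). lia.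
    + assert (N.to_nat i <> N.to_nat j) by (intros E; now apply Hij, N2Nat.inj).
      apply (Hnth (N.to_nat j) (N.to_nat i)). lia.
Qed.

(** * The family of seven points: determinants and distances *)

(* Found by a computer search for sets of points on the Riemann sphere (these
   seven and the point at infinity) obtained from one another by intersecting
   circles. *)
Definition fam (t : R) (i : nat) : point :=
  match i with
  | 0%nat => (0, 0)
  | 1%nat => (1, 0)
  | 2%nat => (1 / 2, - t / (1 - t^2))
  | 3%nat => (1 / 2, - 3 * t / (1 - 9 * t^2))
  | 4%nat => ((1 - 22 * t^2 + 9 * t^4) / (4 * (1 - t^2) * (1 - 9 * t^2)),
              (6 * t^3 - 2 * t) / ((1 - t^2) * (1 - 9 * t^2)))
  | 5%nat => ((9 * t^6 - 31 * t^4 - 9 * t^2 - 1) / (2 * (1 + t^2)^2 * (1 - 9 * t^2)),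
              (15 * t^5 - 2 * t^3 - t) / ((1 + t^2)^2 * (1 - 9 * t^2)))
  | _ => ((81 * t^6 + 81 * t^4 + 31 * t^2 - 1) / (2 * (1 + 9 * t^2)^2 * (1 - t^2)),
          (5 * t - 6 * t^3 - 27 * t^5) / ((1 + 9 * t^2)^2 * (1 - t^2)))
  end.

(** A common denominator of both coordinates. Over the product of the denominators involved, areas
    and distances get polynomial numerators in [t] and [w]; for [cocirc] the product is squared
    because of [norm2]. *)
Definition fam_den (t : R) (i : nat) : R :=
  match i with
  | 0%nat | 1%nat => 1
  | 2%nat => 2 * (1 - t^2)
  | 3%nat => 2 * (1 - 9 * t^2)
  | 4%nat => 4 * (1 - t^2) * (1 - 9 * t^2)
  | 5%nat => 2 * (1 + t^2)^2 * (1 - 9 * t^2)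
  | _ => 2 * (1 + 9 * t^2)^2 * (1 - t^2)
  end.

(** The two middle conditions keep the coordinates well defined; [t] and [1 - 3 * t^2] are factors
    of areas, so their zeros give collinear points. *)
Definition admissible (t : R) : Prop :=
  t <> 0 /\ 1 - t^2 <> 0 /\ 1 - 9 * t^2 <> 0 /\ 1 - 3 * t^2 <> 0.

(** With these facts [lra] proves positivity of any polynomial in [t^2] of degree at most 8 in [t]
    with nonnegative coefficients and positive constant term. *)
Ltac even_powers_ge0 t :=
  pose proof (pow2_ge_0 t);
  assert (0 <= t^4) by (replace (t^4) with ((t^2)^2) by ring; apply pow2_ge_0);
  assert (0 <= t^6) by (replace (t^6) with ((t^3)^2) by ring; apply pow2_ge_0);
  assert (0 <= t^8) by (replace (t^8) with ((t^4)^2) by ring; apply pow2_ge_0).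

Ltac nonzero :=
  repeat first
    [ assumption
    | split
    | apply Rmult_integral_contrapositive_currified
    | apply Rinv_neq_0_compat
    | apply pow_nonzero
    | apply Rgt_not_eq; lra
    | apply Rlt_not_eq; lra ].

Ltac factor_area e :=
  match goal with
  | |- area (fam ?t ?i) (fam ?t ?j) (fam ?t ?k) <> 0 =>
      replace (area (fam t i) (fam t j) (fam t k))
        with (e / (fam_den t i * fam_den t j * fam_den t k))
        by (unfold area, fam, fam_den, fst, snd; field; nonzero);
      unfold fam_den, Rdiv; nonzero
  end.

Ltac factor_cocirc e :=
  match goal with
  | |- cocirc (fam ?t ?i) (fam ?t ?j) (fam ?t ?k) (fam ?t ?l) <> 0 =>
      replace (cocirc (fam t i) (fam t j) (fam t k) (fam t l))
        with (e / (fam_den t i * fam_den t j * fam_den t k * fam_den t l)^2)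
        by (unfold cocirc, norm2, area, fam, fam_den, fst, snd; field; nonzero);
      unfold fam_den, Rdiv; nonzero
  end.

(** One bullet for each of the 35 triples, giving the factored numerator of its area. Every factor
    is a nonzero constant, is excluded from vanishing by [admissible], or is a visibly positive
    polynomial in [t^2]. *)
Lemma fam_area_neq0 (t : R) (i j k : nat) :
  admissible t -> (k < j < i)%nat -> (i < 7)%nat ->
  area (fam t i) (fam t j) (fam t k) <> 0.
Proof.
  intros (H0 & H1 & H9 & H3) Hkj Hi. even_powers_ge0 t.
  destruct i as [| [| [| [| [| [| [| i]]]]]]]; try lia;
  destruct j as [| [| [| [| [| [| j]]]]]]; try lia;
  destruct k as [| [| [| [| [| k]]]]]; try lia.
  - factor_area (2 * t).
  - factor_area (6 * t).
  - factor_area (4 * t * (1 + 3 * t^2)).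
  - factor_area ((-4) * t * (1 + 3 * t^2)).
  - factor_area (8 * t * (1 - 3 * t^2)).
  - factor_area (6 * t * (1 + t^2)^2).
  - factor_area ((-2) * t * (1 - 3 * t^2) * (1 + 5 * t^2)).
  - factor_area (2 * t * (1 + 9 * t^2)^2).
  - factor_area (2 * t * (1 - 3 * t^2) * (5 + 9 * t^2)).
  - factor_area (8 * t * (1 + 3 * t^2) * (1 + 2 * t^2 + 9 * t^4)).
  - factor_area (2 * t * (1 - 3 * t^2) * (1 + 5 * t^2)).
  - factor_area (4 * t * (1 + t^2)^2 * (1 + 3 * t^2)).
  - factor_area (4 * t * (1 - 3 * t^2) * (1 + 7 * t^4)).
  - factor_area (8 * t * (1 + 3 * t^2) * (1 + 2 * t^2 + 9 * t^4)).
  - factor_area (16 * t * (1 - 3 * t^2) * (1 + 2 * t^2 + 9 * t^4)).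
  - factor_area (16 * (1 - t^2) * t * (1 + 3 * t^2) * (1 + 2 * t^2 + 9 * t^4)).
  - factor_area (2 * t * (1 + t^2)^2 * (1 - 3 * t^2) * (5 + 9 * t^2)).
  - factor_area (2 * t * (1 - 3 * t^2)^2 * (81 * t^4 + 10 * t^2 + 9)).
  - factor_area (16 * t * (1 + t^2)^2 * (1 - 3 * t^2) * (1 + 2 * t^2 + 9 * t^4)).
  - factor_area ((-8) * (1 - 9 * t^2) * t * (1 - 3 * t^2) * (1 + 7 * t^2 + 19 * t^4 + 45 * t^6)).
  - factor_area ((-2) * t * (1 - 3 * t^2) * (5 + 9 * t^2)).
  - factor_area ((-8) * t * (1 + 3 * t^2) * (1 + 2 * t^2 + 9 * t^4)).
  - factor_area (16 * t * (1 - 3 * t^2) * (1 + 2 * t^2 + 9 * t^4)).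
  - factor_area ((-4) * t * (1 + 9 * t^2)^2 * (1 + 3 * t^2)).
  - factor_area (4 * t * (1 - 3 * t^2) * (7 + 81 * t^4)).
  - factor_area (16 * (1 - 9 * t^2) * t * (1 + 3 * t^2) * (1 + 2 * t^2 + 9 * t^4)).
  - factor_area ((-2) * t * (1 + 9 * t^2)^2 * (1 - 3 * t^2) * (1 + 5 * t^2)).
  - factor_area (6 * t * (1 - 3 * t^2)^2 * (81 * t^4 + 10 * t^2 + 9)).
  - factor_area (8 * (1 - t^2) * t * (1 - 3 * t^2) * (5 + 19 * t^2 + 63 * t^4 + 81 * t^6)).
  - factor_area (16 * t * (1 + 9 * t^2)^2 * (1 - 3 * t^2) * (1 + 2 * t^2 + 9 * t^4)).
  - factor_area (4 * t * (1 - 3 * t^2)^2 * (1 + 3 * t^2) * (3 + 14 * t^2 + 27 * t^4)).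
  - factor_area (4 * t * (1 - 3 * t^2)^2 * (1 + 3 * t^2) * (81 * t^4 + 10 * t^2 + 9)).
  - factor_area (16 * t * (1 - 3 * t^2) * (1 + 3 * t^2) * (3 + 10 * t^2 + 44 * t^4 + 54 * t^6 + 81 * t^8)).
  - factor_area (48 * t * (1 - 3 * t^2) * (1 + 3 * t^2) * (1 + 6 * t^2 + 44 * t^4 + 90 * t^6 + 243 * t^8)).
  - factor_area (8 * t * (1 - 3 * t^2)^2 * (1 + 3 * t^2) * (81 * t^4 + 10 * t^2 + 9) * (1 + 2 * t^2 + 9 * t^4)).
Qed.

(** The same scheme for the 35 quadruples, with the same kinds of factors. *)
Lemma fam_cocirc_neq0 (t : R) (i j k l : nat) :
  admissible t -> (l < k < j)%nat -> (j < i < 7)%nat ->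
  cocirc (fam t i) (fam t j) (fam t k) (fam t l) <> 0.
Proof.
  intros (H0 & H1 & H9 & H3) Hlk Hji. even_powers_ge0 t.
  destruct i as [| [| [| [| [| [| [| i]]]]]]]; try lia;
  destruct j as [| [| [| [| [| [| j]]]]]]; try lia;
  destruct k as [| [| [| [| [| k]]]]]; try lia;
  destruct l as [| [| [| [| l]]]]; try lia.
  - factor_cocirc (8 * t * (1 + 3 * t^2) * (1 + 2 * t^2 + 9 * t^4)).
  - factor_cocirc (4 * (1 - t^2) * t * (1 + t^2)^2 * (1 - 3 * t^2) * (5 + 9 * t^2)).
  - factor_cocirc ((-4) * (1 - 9 * t^2) * t * (1 + 9 * t^2)^2 * (1 - 3 * t^2) * (1 + 5 * t^2)).
  - factor_cocirc ((-16) * (1 - t^2) * (1 - 9 * t^2) * t * (1 + t^2)^2 * (1 + 9 * t^2)^2 * (1 + 3 * t^2)).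
  - factor_cocirc ((-16) * (1 - t^2) * (1 - 9 * t^2) * t * (1 - 3 * t^2)^2 * (1 + 3 * t^2) * (3 + 14 * t^2 + 27 * t^4)).
  - factor_cocirc (16 * t * (1 + t^2)^4 * (1 - 3 * t^2) * (1 + 2 * t^2 + 9 * t^4)).
  - factor_cocirc (8 * (1 - 9 * t^2) * t * (1 + t^2)^2 * (1 - 3 * t^2) * (5 + 19 * t^2 + 63 * t^4 + 81 * t^6)).
  - factor_cocirc (32 * (1 - 9 * t^2)^2 * t * (1 + t^2)^4 * (1 + 3 * t^2) * (1 + 2 * t^2 + 9 * t^4)).
  - factor_cocirc ((-32) * (1 - 9 * t^2) * t * (1 + t^2)^2 * (1 - 3 * t^2) * (1 + 3 * t^2) * (3 + 10 * t^2 + 44 * t^4 + 54 * t^6 + 81 * t^8)).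
  - factor_cocirc (12 * (1 - 9 * t^2) * t * (1 + t^2)^4 * (1 - 3 * t^2)^2 * (81 * t^4 + 10 * t^2 + 9)).
  - factor_cocirc (16 * (1 - t^2) * (1 - 9 * t^2) * t * (1 + t^2)^6 * (1 - 3 * t^2) * (7 + 81 * t^4)).
  - factor_cocirc ((-16) * (1 - t^2) * (1 - 9 * t^2) * t * (1 + t^2)^4 * (1 - 3 * t^2)^2 * (1 + 3 * t^2) * (81 * t^4 + 10 * t^2 + 9)).
  - factor_cocirc (64 * (1 - 9 * t^2)^2 * t * (1 + t^2)^4 * (1 + 9 * t^2)^2 * (1 - 3 * t^2) * (1 + 2 * t^2 + 9 * t^4)).
  - factor_cocirc (32 * (1 - 9 * t^2)^2 * t * (1 + t^2)^2 * (1 - 3 * t^2)^2 * (1 + 3 * t^2) * (81 * t^4 + 10 * t^2 + 9) * (1 + 2 * t^2 + 9 * t^4)).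
  - factor_cocirc (384 * (1 - t^2) * (1 - 9 * t^2)^2 * t * (1 + t^2)^4 * (1 - 3 * t^2) * (1 + 3 * t^2) * (1 + 6 * t^2 + 44 * t^4 + 90 * t^6 + 243 * t^8)).
  - factor_cocirc ((-8) * (1 - t^2) * t * (1 + 9 * t^2)^2 * (1 - 3 * t^2) * (1 + 7 * t^2 + 19 * t^4 + 45 * t^6)).
  - factor_cocirc (16 * t * (1 + 9 * t^2)^4 * (1 - 3 * t^2) * (1 + 2 * t^2 + 9 * t^4)).
  - factor_cocirc (32 * (1 - t^2)^2 * t * (1 + 9 * t^2)^4 * (1 + 3 * t^2) * (1 + 2 * t^2 + 9 * t^4)).
  - factor_cocirc ((-96) * (1 - t^2) * t * (1 + 9 * t^2)^2 * (1 - 3 * t^2) * (1 + 3 * t^2) * (1 + 6 * t^2 + 44 * t^4 + 90 * t^6 + 243 * t^8)).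
  - factor_cocirc (4 * (1 - t^2) * t * (1 + 9 * t^2)^4 * (1 - 3 * t^2)^2 * (81 * t^4 + 10 * t^2 + 9)).
  - factor_cocirc (64 * (1 - t^2)^2 * t * (1 + t^2)^2 * (1 + 9 * t^2)^4 * (1 - 3 * t^2) * (1 + 2 * t^2 + 9 * t^4)).
  - factor_cocirc ((-32) * (1 - t^2)^2 * t * (1 + 9 * t^2)^2 * (1 - 3 * t^2)^2 * (1 + 3 * t^2) * (81 * t^4 + 10 * t^2 + 9) * (1 + 2 * t^2 + 9 * t^4)).
  - factor_cocirc (16 * (1 - t^2) * (1 - 9 * t^2) * t * (1 + 9 * t^2)^6 * (1 - 3 * t^2) * (1 + 7 * t^4)).
  - factor_cocirc (16 * (1 - t^2) * (1 - 9 * t^2) * t * (1 + 9 * t^2)^4 * (1 - 3 * t^2)^2 * (1 + 3 * t^2) * (81 * t^4 + 10 * t^2 + 9)).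
  - factor_cocirc (128 * (1 - t^2)^2 * (1 - 9 * t^2) * t * (1 + 9 * t^2)^4 * (1 - 3 * t^2) * (1 + 3 * t^2) * (3 + 10 * t^2 + 44 * t^4 + 54 * t^6 + 81 * t^8)).
  - factor_cocirc (8 * t * (1 + t^2)^2 * (1 + 9 * t^2)^2 * (1 - 3 * t^2)^2 * (1 + 3 * t^2) * (81 * t^4 + 10 * t^2 + 9) * (1 + 2 * t^2 + 9 * t^4)).
  - factor_cocirc (96 * (1 - t^2) * t * (1 + t^2)^4 * (1 + 9 * t^2)^2 * (1 - 3 * t^2) * (1 + 3 * t^2) * (1 + 6 * t^2 + 44 * t^4 + 90 * t^6 + 243 * t^8)).
  - factor_cocirc ((-32) * (1 - t^2)^2 * t * (1 + t^2)^2 * (1 + 9 * t^2)^2 * (1 - 3 * t^2)^2 * (1 + 3 * t^2) * (81 * t^4 + 10 * t^2 + 9) * (1 + 2 * t^2 + 9 * t^4)).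
  - factor_cocirc (32 * (1 - 9 * t^2) * t * (1 + t^2)^2 * (1 + 9 * t^2)^4 * (1 - 3 * t^2) * (1 + 3 * t^2) * (3 + 10 * t^2 + 44 * t^4 + 54 * t^6 + 81 * t^8)).
  - factor_cocirc ((-32) * (1 - 9 * t^2)^2 * t * (1 + t^2)^2 * (1 + 9 * t^2)^2 * (1 - 3 * t^2)^2 * (1 + 3 * t^2) * (81 * t^4 + 10 * t^2 + 9) * (1 + 2 * t^2 + 9 * t^4)).
  - factor_cocirc (8192 * (1 - t^2) * (1 - 9 * t^2) * t^3 * (1 + t^2)^2 * (1 + 9 * t^2)^2 * (1 - 3 * t^2) * (1 + 3 * t^2)^2 * (1 + 4 * t^2 + 22 * t^4 + 36 * t^6 + 81 * t^8)).
  - factor_cocirc (16 * (1 - t^2) * (1 - 9 * t^2) * t * (1 + t^2)^4 * (1 + 9 * t^2)^4 * (1 - 3 * t^2)^2 * (1 + 3 * t^2) * (81 * t^4 + 10 * t^2 + 9)).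
  - factor_cocirc ((-16) * (1 - t^2) * (1 - 9 * t^2) * t * (1 + t^2)^2 * (1 + 9 * t^2)^2 * (1 - 3 * t^2)^4 * (1 + 3 * t^2) * (81 * t^4 + 10 * t^2 + 9)^2).
  - factor_cocirc ((-128) * (1 - t^2)^2 * (1 - 9 * t^2)^2 * t * (1 + t^2)^4 * (1 + 9 * t^2)^2 * (1 - 3 * t^2)^2 * (1 + 3 * t^2) * (81 * t^4 + 10 * t^2 + 9) * (1 + 2 * t^2 + 9 * t^4)).
  - factor_cocirc ((-128) * (1 - t^2)^2 * (1 - 9 * t^2)^2 * t * (1 + t^2)^2 * (1 + 9 * t^2)^4 * (1 - 3 * t^2)^2 * (1 + 3 * t^2) * (81 * t^4 + 10 * t^2 + 9) * (1 + 2 * t^2 + 9 * t^4)).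
Qed.

Ltac rational_dist e Hw :=
  match goal with
  | |- rational (dist (fam ?t ?i) (fam ?t ?j)) =>
      rewrite (dist_unique _ _ (e / (fam_den t i * fam_den t j)));
      [ apply rational_Rabs; unfold fam_den; rational_tac
      | unfold Rdiv; rewrite ?Rpow_mult_distr, ?Hw;
        unfold fam, fam_den, fst, snd; field; nonzero ]
  end.

(** Each squared distance is the square of a rational function of [t], times [w^2] exactly for the
    six pairs among the points 1, 4, 5, 6. These pairs are what forces [t] onto the elliptic
    curve. *)
Lemma fam_dist_rational (t w : R) (i j : nat) :
  admissible t -> rational t -> rational w -> w^2 = 81 * t^4 + 10 * t^2 + 9 ->
  (j < i < 7)%nat -> rational (dist (fam t i) (fam t j)).
Proof.
  intros (H0 & H1 & H9 & H3) Ht Hwr Hw Hij. even_powers_ge0 t.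
  destruct i as [| [| [| [| [| [| [| i]]]]]]]; try lia;
  destruct j as [| [| [| [| [| [| j]]]]]]; try lia.
  - rational_dist 1 Hw.
  - rational_dist (1 + t^2) Hw.
  - rational_dist (1 + t^2) Hw.
  - rational_dist (1 + 9 * t^2) Hw.
  - rational_dist (1 + 9 * t^2) Hw.
  - rational_dist (8 * t * (1 + 3 * t^2)) Hw.
  - rational_dist ((1 + t^2) * (1 + 9 * t^2)) Hw.
  - rational_dist (w * (1 - 3 * t^2)) Hw.
  - rational_dist (2 * (1 - t) * (1 + t) * (1 + t^2) * (1 + 9 * t^2)) Hw.
  - rational_dist (2 * (1 - 3 * t) * (1 + 3 * t) * (1 + t^2) * (1 + 9 * t^2)) Hw.
  - rational_dist ((1 + t^2)^2 * (1 + 9 * t^2)) Hw.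
  - rational_dist (w * (1 + t^2) * (1 - 3 * t^2)) Hw.
  - rational_dist (4 * (1 + t^2)^2 * (1 - 2 * t^2 + 9 * t^4)) Hw.
  - rational_dist (4 * (1 - 3 * t) * (1 + 3 * t) * (1 + t^2) * (1 + 2 * t^2 + 9 * t^4)) Hw.
  - rational_dist (2 * w * (1 - 3 * t) * (1 + 3 * t) * (1 + t^2)^2 * (1 - 3 * t^2)) Hw.
  - rational_dist ((1 + t^2) * (1 + 9 * t^2)^2) Hw.
  - rational_dist (w * (1 + 9 * t^2) * (1 - 3 * t^2)) Hw.
  - rational_dist (4 * (1 - t) * (1 + t) * (1 + 9 * t^2) * (1 + 2 * t^2 + 9 * t^4)) Hw.
  - rational_dist (4 * (1 + 9 * t^2)^2 * (1 - 2 * t^2 + 9 * t^4)) Hw.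
  - rational_dist (2 * w * (1 - t) * (1 + t) * (1 + 9 * t^2)^2 * (1 - 3 * t^2)) Hw.
  - rational_dist (8 * w * t * (1 + t^2) * (1 + 9 * t^2) * (1 - 3 * t^2) * (1 + 3 * t^2)) Hw.
Qed.

(** * Infinitely many rational parameters by doubling on the quartic *)

(* The points [(p/q, z/q^2)] on [w^2 = 81 t^4 + 10 t^2 + 9]; each step doubles
   the previous point, by the duplication formula of a Jacobi quartic with
   neutral element [(0, 3)]. *)
Fixpoint orbit (n : nat) : Z * Z * Z :=
  match n with
  | O => (2, 5, 89)
  | S n =>
      let '(p, q, z) := orbit n in
      (2 * p * q * z, 3 * (q^4 - 9 * p^4),
       3 * (q^4 + 9 * p^4) * (z^2 + 10 * p^2 * q^2) + 972 * p^4 * q^4)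
  end%Z.

(** With [w = 3 * y] the curve becomes the Jacobi quartic [y^2 = 9 * t^4 + (10/9) * t^2 + 1].
    Clearing denominators in its duplication formula yields these expressions, with [972 = 27 * 36].
    Since [z] enters only through [z^2], substituting the curve equation leaves an identity in [p]
    and [q]. *)
Lemma orbit_step_on_curve (p q z : Z) :
  (z^2 = 81 * p^4 + 10 * p^2 * q^2 + 9 * q^4 ->
   (3 * (q^4 + 9 * p^4) * (z^2 + 10 * p^2 * q^2) + 972 * p^4 * q^4)^2
   = 81 * (2 * p * q * z)^4
     + 10 * (2 * p * q * z)^2 * (3 * (q^4 - 9 * p^4))^2
     + 9 * (3 * (q^4 - 9 * p^4))^4)%Z.
Proof.
  intros Hz.
  replace ((2 * p * q * z)^4)%Z with (16 * p^4 * q^4 * (z^2)^2)%Z by ring.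
  replace ((2 * p * q * z)^2)%Z with (4 * p^2 * q^2 * z^2)%Z by ring.
  rewrite Hz. ring.
Qed.

(** The new numerator [2 * p * q * z] gains exactly one factor 2, because [q] and [z] are odd; they
    stay odd because [p] is even. *)
Lemma orbit_spec (n : nat) :
  exists p q z u : Z, orbit n = (p, q, z) /\
    (z^2 = 81 * p^4 + 10 * p^2 * q^2 + 9 * q^4)%Z /\
    Z.odd q = true /\ Z.odd z = true /\ Z.odd u = true /\
    (p = 2 * 2 ^ Z.of_nat n * u)%Z.
Proof.
  induction n as [| n (p & q & z & u & E & Hz & Hq & Ho & Hu & Hp)].
  - exists 2%Z, 5%Z, 89%Z, 1%Z. repeat split.
  - assert (Hpe : Z.odd p = false).
    { rewrite Hp, !Z.odd_mul. reflexivity. }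
    cbn [orbit]. rewrite E.
    do 3 eexists. exists (u * q * z)%Z. split; [reflexivity |].
    split; [now apply orbit_step_on_curve |].
    assert (Hodd4 : forall x : Z, Z.odd (x ^ 4) = Z.odd x)
      by (intros x; now apply Z.odd_pow).
    assert (Hodd2 : forall x : Z, Z.odd (x ^ 2) = Z.odd x)
      by (intros x; now apply Z.odd_pow).
    repeat rewrite ?Z.odd_mul, ?Z.odd_add, ?Z.odd_sub, ?Hodd4, ?Hodd2.
    rewrite Hq, Ho, Hu, Hpe.
    repeat split. rewrite Hp, Nat2Z.inj_succ, Z.pow_succ_r by lia. ring.
Qed.

Definition param (n : nat) : R :=
  let '(p, q, z) := orbit n in IZR p / IZR q.

Lemma odd_neq0 (k : Z) : Z.odd k = true -> IZR k <> 0.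
Proof. intros Hk. apply not_0_IZR. intros ->. discriminate. Qed.

(** Multiplied by [q^2] the expression becomes [q^2 - c * p^2], an odd integer. The values 1, 9 and
    3 of [c] give three of the conditions in [admissible]. *)
Lemma one_minus_sqr_neq0 (c p q : Z) :
  Z.odd p = false -> Z.odd q = true -> 1 - IZR c * (IZR p / IZR q) ^ 2 <> 0.
Proof.
  intros Hp Hq E.
  assert (Hq0 := odd_neq0 q Hq).
  apply (odd_neq0 (q * q - c * (p * p))).
  - now rewrite Z.odd_sub, !Z.odd_mul, Hp, Hq, Bool.andb_false_r.
  - rewrite minus_IZR, !mult_IZR.
    transitivity ((1 - IZR c * (IZR p / IZR q) ^ 2) * IZR q ^ 2); [field; exact Hq0 |].
    rewrite E. ring.
Qed.

Lemma param_spec (n : nat) :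
  admissible (param n) /\ rational (param n) /\
  exists w, rational w /\ w^2 = 81 * param n ^ 4 + 10 * param n ^ 2 + 9.
Proof.
  destruct (orbit_spec n) as (p & q & z & u & E & Hz & Hq & Ho & Hu & Hp).
  unfold param. rewrite E.
  assert (Hq0 := odd_neq0 q Hq).
  assert (Hpe : Z.odd p = false) by (rewrite Hp, !Z.odd_mul; reflexivity).
  split; [| split].
  - split; [| split; [| split]].
    + unfold Rdiv. apply Rmult_integral_contrapositive_currified.
      * rewrite Hp, !mult_IZR. repeat apply Rmult_integral_contrapositive_currified.
        -- lra.
        -- apply not_0_IZR. lia.
        -- now apply odd_neq0.
      * now apply Rinv_neq_0_compat.
    + rewrite <- (Rmult_1_l ((IZR p / IZR q) ^ 2)).
      now apply (one_minus_sqr_neq0 1).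
    + now apply (one_minus_sqr_neq0 9).
    + now apply (one_minus_sqr_neq0 3).
  - exists p, q. split; [intros ->; discriminate | reflexivity].
  - exists (IZR z / IZR (q * q)). split.
    + exists z, (q * q)%Z. split; [| reflexivity].
      intros Hqq. assert (q = 0%Z) as -> by nia. discriminate.
    + assert (Hz' : (z * z = 81 * (p * p * p * p) + 10 * (p * p * (q * q))
                             + 9 * (q * q * q * q))%Z)
        by (rewrite <- Z.pow_2_r, Hz; ring).
      apply (f_equal IZR) in Hz'. rewrite !plus_IZR, !mult_IZR in Hz'.
      rewrite mult_IZR.
      replace ((IZR z / (IZR q * IZR q))^2)
        with (IZR z * IZR z / (IZR q * IZR q)^2) by (field; exact Hq0).
      rewrite Hz'. field. exact Hq0.
Qed.

(** * A quotient that separates the parameters *)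

(** Only the first three points enter, so the same quotient serves 6-clusters and 7-clusters. *)
Definition shape (n : nat) : R :=
  dist (fam (param n) 2) (fam (param n) 0) / dist (fam (param n) 1) (fam (param n) 0).

Lemma shape_eq (n : nat) :
  shape n = Rabs ((1 + param n ^ 2) / (2 * (1 - param n ^ 2))).
Proof.
  destruct (param_spec n) as ((_ & H1 & _) & _).
  unfold shape.
  rewrite (dist_unique (fam _ 2) _ ((1 + param n ^ 2) / (2 * (1 - param n ^ 2)))),
    (dist_unique (fam _ 1) _ 1).
  - rewrite Rabs_R1. field.
  - unfold fam, fst, snd. ring.
  - unfold fam, fst, snd. field. exact H1.
Qed.

(** The absolute values leave a sign. For equal signs the Moebius map [(1 + x) / (1 - x)] is
    injective; for opposite signs it is [x -> 1 / x] that negates it. *)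
Lemma moebius_sqr_eq (x y : R) :
  1 - x <> 0 -> 1 - y <> 0 ->
  Rabs ((1 + x) / (2 * (1 - x))) = Rabs ((1 + y) / (2 * (1 - y))) ->
  x = y \/ x * y = 1.
Proof.
  intros Hx Hy E.
  assert (Hsame : forall e, e * e = 1 ->
    (1 + x) / (2 * (1 - x)) = e * ((1 + y) / (2 * (1 - y))) ->
    (1 + x) * (1 - y) = e * ((1 + y) * (1 - x))).
  { intros e _ Ee.
    transitivity ((1 + x) / (2 * (1 - x)) * (2 * (1 - x) * (1 - y))); [now field |].
    rewrite Ee. now field. }
  destruct (Rsqr_eq _ _ (Rsqr_eq_asb_1 _ _ E)) as [E' | E'].
  - left. enough ((1 + x) * (1 - y) = 1 * ((1 + y) * (1 - x))) by lra.
    apply Hsame; lra.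
  - right. enough ((1 + x) * (1 - y) = -1 * ((1 + y) * (1 - x))) by lra.
    apply Hsame; lra.
Qed.

(* Compares 2-adic valuations. *)
Lemma two_adic_lt_neq (m n : nat) (u v q r : Z) :
  Z.odd u = true -> Z.odd r = true -> (m < n)%nat ->
  ((2 * 2 ^ Z.of_nat m * u * r)^2 <> (2 * 2 ^ Z.of_nat n * v * q)^2)%Z.
Proof.
  intros Hu Hr Hmn E.
  replace (Z.of_nat n) with (Z.of_nat m + Z.succ (Z.of_nat (n - m - 1)))%Z in E by lia.
  rewrite Z.pow_add_r, Z.pow_succ_r in E by lia.
  set (a := (2 ^ Z.of_nat m)%Z) in E.
  set (b := (2 ^ Z.of_nat (n - m - 1))%Z) in E.
  assert (Ha : a <> 0%Z) by (unfold a; lia).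
  assert (E' : (u * r * (u * r) = 2 * (2 * (b * v * q) * (b * v * q)))%Z).
  { apply Z.mul_reg_l with (4 * (a * a))%Z; [nia |].
    transitivity ((2 * a * u * r) ^ 2)%Z; [ring |]. rewrite E. ring. }
  apply (f_equal Z.odd) in E'. rewrite !(Z.odd_mul (u * r)), !(Z.odd_mul u), Hu, Hr in E'.
  rewrite Z.odd_mul in E'. discriminate.
Qed.

(** Equal values mean that the squared parameters are equal or inverse to each other. Equality is
    settled by 2-adic valuations, which determine the index. *)
Lemma shape_injective (m n : nat) : shape m = shape n -> m = n.
Proof.
  rewrite !shape_eq. intros E.
  destruct (param_spec m) as ((_ & Hm & _) & _), (param_spec n) as ((_ & Hn & _) & _).
  apply moebius_sqr_eq in E; [| exact Hm | exact Hn]. clear Hm Hn. revert E.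
  destruct (orbit_spec m) as (p & q & z & u & Em & _ & Hq & _ & Hu & Hp).
  destruct (orbit_spec n) as (p' & q' & z' & u' & En & _ & Hq' & _ & Hu' & Hp').
  unfold param. rewrite Em, En. intros [E | E].
  - assert (EZ : ((p * q')^2 = (p' * q)^2)%Z).
    { apply eq_IZR. rewrite !Z.pow_2_r, !mult_IZR.
      transitivity ((IZR p / IZR q)^2 * (IZR q * IZR q')^2);
        [field; now apply odd_neq0 |].
      rewrite E. field. now apply odd_neq0. }
    rewrite Hp, Hp' in EZ.
    destruct (Nat.lt_trichotomy m n) as [Hlt | [Heq | Hlt]]; [| exact Heq |].
    + now apply two_adic_lt_neq in EZ.
    + symmetry in EZ. now apply two_adic_lt_neq in EZ.
  (* The inverse case fails by parity: both numerators are even and both denominators odd. *)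
  - assert (EZ : ((p * p')^2 = (q * q')^2)%Z).
    { apply eq_IZR. rewrite !Z.pow_2_r, !mult_IZR.
      transitivity ((IZR p / IZR q)^2 * (IZR p' / IZR q')^2 * (IZR q * IZR q')^2);
        [field; split; now apply odd_neq0 |].
      rewrite E. ring. }
    apply (f_equal Z.odd) in EZ.
    rewrite !Z.pow_2_r, Hp, !Z.odd_mul, Hq, Hq' in EZ. discriminate.
Qed.

(** * Arbitrarily many non-similar clusters *)

(** Three points are required by [cluster_config] and by [shape]; seven is the size of the family.
    As [M] is arbitrary, both counts of the theorem are instances. *)
Lemma many_nonsimilar_clusters (k : nat) (M : N) :
  (3 <= k <= 7)%nat ->
  exists C : N -> pointset,
    (forall i : N, (i < M)%N -> cluster k (C i)) /\
    (forall i j : N, (i < M)%N -> (j < M)%N -> i <> j -> ~ similar (C i) (C j)).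
Proof.
  intros Hk.
  (* Keeping the explicit form of [P] makes its finitely many quotients, and [shape n] among them,
     accessible. *)
  pose (good := fun (n : nat) (P : pointset) => exists N : R, N <> 0 /\
    P = config (fun i => homothety N (fam (param n) i)) k /\ cluster k P).
  assert (Hunit : forall n, dist (fam (param n) 1) (fam (param n) 0) <> 0).
  { intros n. rewrite (dist_unique _ _ 1) by (unfold fam, fst, snd; ring).
    rewrite Rabs_R1. lra. }
  destruct (greedy_nonsimilar good shape) with (N := N.to_nat M)
    as (l & Hl & Hgood & Hpairs).
  - intros n.
    destruct (param_spec n) as (Hadm & Hrat & w & Hw & Hcurve).
    destruct (cluster_config (fam (param n)) k) as (N & HN & HC).
    + lia.
    + intros i j l Hlj Hi. apply fam_area_neq0; [exact Hadm | lia | lia].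
    + intros i j l l' Hl Hj. apply fam_cocirc_neq0; [exact Hadm | lia | lia].
    + intros i Hi. split;
        destruct i as [| [| [| [| [| [| i]]]]]]; unfold fam, fst, snd, Rdiv; rational_tac.
    + intros i j Hi Hj. destruct (Nat.lt_trichotomy i j) as [Hij | [-> | Hij]].
      * rewrite dist_sym. apply (fam_dist_rational _ w); auto. lia.
      * rewrite dist_refl. apply rational_IZR.
      * apply (fam_dist_rational _ w); auto. lia.
    + exists (config (fun i => homothety N (fam (param n) i)) k), N. auto.
  - apply shape_injective.
  - intros n P (N & _ & -> & _). apply ratio_set_config_finite.
  - intros n P (N & HN & -> & _). split.
    (* The indices are those in the definition of [shape]. *)
    + apply (ratio_set_homothety N (fam (param n)) k 2 0 1 0); auto; lia.
    + exists (homothety N (fam (param n) 1)), (homothety N (fam (param n) 0)).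
      split; [exists 1%nat; split; [lia | reflexivity] |].
      split; [exists 0%nat; split; [lia | reflexivity] |].
      rewrite dist_homothety. apply Rmult_integral_contrapositive_currified.
      * now apply Rabs_no_R0.
      * apply Hunit.
  - apply (nonsimilar_family_of_list k M l Hl); [| exact Hpairs].
    revert Hgood. apply Forall_impl. intros P (n & N & _ & _ & HP). exact HP.
Qed.

Theorem mainTheorem2 :
  (exists C : N -> pointset,
     (forall i : N, (i < 1154)%N -> cluster 7 (C i)) /\
     (forall i j : N, (i < 1154)%N -> (j < 1154)%N -> i <> j ->
        ~ similar (C i) (C j))) /\
  (exists C : N -> pointset,
     (forall i : N, (i < 435696)%N -> cluster 6 (C i)) /\
     (forall i j : N, (i < 435696)%N -> (j < 435696)%N -> i <> j ->
        ~ similar (C i) (C j))).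
Proof.
  split.
  - apply (many_nonsimilar_clusters 7 1154). lia.
  - apply (many_nonsimilar_clusters 6 435696). lia.
Qed.
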